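(* For every integer $d\ge 1$ there exists a constant $c$ depending only on $d$ such that for every finite family $\mathcal{F}$ of axis-parallel cubes in $\mathbb{R}^d$ we have $\tau(\mathcal{F}) \leq c\,\nu(\mathcal{F})$.
   Context: An axis-parallel box in $\mathbb{R}^d$ is a set $[x_1,y_1]\times\dots\times[x_d,y_d]$ with $x_i<y_i$ for all $i$; it is a cube if all its side lengths $y_i-x_i$ are equal. For a family $\mathcal{F}$ of boxes, $\nu(\mathcal{F})$ (matching number) is the maximum size of a subfamily of pairwise disjoint boxes, and $\tau(\mathcal{F})$ (covering number) is the minimum size of a set of points in $\mathbb{R}^d$ that meets every box in $\mathcal{F}$. *)

(* Defs.v *)
From HB Require Import structures.
From mathcomp Require Import all_boot all_order all_algebra finmap.
From mathcomp Require Import boolp classical_sets reals.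
Set Implicit Arguments.
Unset Strict Implicit.
Unset Printing Implicit Defensive.
Import Order.TTheory GRing.Theory Num.Theory.
Local Open Scope fset_scope.
Local Open Scope classical_set_scope.
Local Open Scope ring_scope.

Record abox (R : realType) (d : nat) := ABox {
  lo : 'rV[R]_d;
  hi : 'rV[R]_d;
  lo_lt_hi : forall i : 'I_d, lo 0 i < hi 0 i }.

Definition abox_set (R : realType) (d : nat) (B : abox R d) : set 'rV[R]_d :=
  [set p | forall i : 'I_d, lo B 0 i <= p 0 i <= hi B 0 i].

Definition is_cube (R : realType) (d : nat) (B : abox R d) : Prop :=
  forall i j : 'I_d, hi B 0 i - lo B 0 i = hi B 0 j - lo B 0 j.

(* Finite families are indexed by a finite type, so repetitions are allowed;
   they change neither number below, since boxes are nonempty. *)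
Section Numbers.
Variables (R : realType) (d : nat) (I : finType) (F : I -> abox R d).

Definition is_matching (M : {set I}) : Prop :=
  forall i j : I, i \in M -> j \in M -> i != j ->
    abox_set (F i) `&` abox_set (F j) = set0.

Definition matching_number : nat :=
  (\max_(M : {set I} | `[< is_matching M >]) #|M|)%N.

Definition is_cover (P : {fset 'rV[R]_d}) : Prop :=
  forall i : I, exists2 p : 'rV[R]_d, p \in P & abox_set (F i) p.

Definition is_cover_size (n : nat) : bool :=
  `[< exists2 P : {fset 'rV[R]_d}, is_cover P & #|` P| = n >].

Lemma is_cover_size_ex : exists n, is_cover_size n.
Proof.
exists #|` [fset lo (F i) | i in I]|; apply/asboolP.
exists [fset lo (F i) | i in I] => // i.
exists (lo (F i)); first exact: in_imfset.
by move=> j; rewrite lexx ltW // lo_lt_hi.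
Qed.

Definition covering_number : nat := ex_minn is_cover_size_ex.

End Numbers.

(* Main.v *)
Require Import Defs.
From mathcomp Require Import finmap boolp classical_sets.
From mathcomp Require Import all_boot all_order all_algebra reals.
Set Implicit Arguments.
Unset Strict Implicit.
Unset Printing Implicit Defensive.
Import Order.TTheory GRing.Theory Num.Theory.
Local Open Scope ring_scope.

(** Run the greedy algorithm: repeatedly pick a smallest remaining cube and
    discard all cubes that meet it. The picked cubes are pairwise disjoint, and
    every cube of the family meets a picked cube that is no larger than itself
    ([small_matching]). Now if a cube [Q'] meets a cube [Q] that is no larger,
    then [Q'] contains a vertex of [Q] ([corner_in_larger_box]): this can be
    checked in each coordinate separately, where it says that an interval
    meeting another one that is no longer contains one of its endpoints. Hence
    the vertices of the picked cubes cover the family, and since each cube has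
    [2 ^ d] of them, the constant [c = 2 ^ d] works. *)

Lemma leq_matching_number (R : realType) (d : nat) (I : finType)
    (F : I -> abox R d) (M : {set I}) :
  is_matching F M -> (#|M| <= matching_number F)%N.
Proof.
move=> hM; rewrite /matching_number.
by apply: (@leq_bigmax_cond _ _ (fun M : {set I} => #|M|)); apply/asboolP.
Qed.

Lemma covering_number_leq (R : realType) (d : nat) (I : finType)
    (F : I -> abox R d) (P : {fset 'rV[R]_d}) :
  is_cover F P -> (covering_number F <= #|` P|)%N.
Proof.
move=> hP; rewrite /covering_number; case: ex_minnP => n _; apply.
by apply/asboolP; exists P.
Qed.

(** The greedy choice with respect to an arbitrary weight [w]. It is stated for
    the members of a subset [A] so that it can be proved by induction on the
    size of [A]: the lightest box of [A] is selected, and the induction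
    hypothesis is applied to the boxes of [A] that do not meet it; those that
    meet it are at least as heavy by minimality. *)
Lemma small_matching (R : realType) (d : nat) (I : finType)
    (F : I -> abox R d) (w : I -> R) (A : {set I}) :
  exists M : {set I}, [/\ M \subset A, is_matching F M &
    forall i, i \in A -> exists j, [/\ j \in M, w j <= w i &
      exists p, abox_set (F i) p /\ abox_set (F j) p]].
Proof.
have [n] := ubnP #|A|; elim: n A => // n IHn A leAn.
have [->|[a0 a0A]] := set_0Vmem A.
  by exists set0; split=> // [i j|i]; rewrite inE.
have [a aA amin] : exists2 a, a \in A & forall i, i \in A -> w a <= w i.
  by have [a aA amin] := arg_minP w a0A; exists a.
pose meets i j := `[< exists p, abox_set (F i) p /\ abox_set (F j) p >].
have meets_refl i : meets i i.
  apply/asboolP; exists (lo (F i)).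
  by split=> k; rewrite lexx ltW // lo_lt_hi.
pose B := [set i in A | ~~ meets i a].
have BA : (#|B| < #|A|)%N.
  apply/proper_card/properP; split; first by apply/subsetP => i /setIdP[].
  by exists a => //; rewrite inE meets_refl andbF.
have [M [MB matchM coverM]] := IHn B (leq_trans BA leAn).
have disj i : i \in M ->
    (abox_set (F i) `&` abox_set (F a) = classical_sets.set0)%classic.
  move=> /(subsetP MB) /setIdP[_ /asboolP ia].
  by rewrite -classical_sets.subset0 => p ip; apply: ia; exists p.
exists (a |: M); split.
- rewrite subUset sub1set aA; apply: subset_trans MB _.
  by apply/subsetP => i /setIdP[].
- move=> i j /setU1P[->|iM] /setU1P[->|jM] ij; first by rewrite eqxx in ij.
  + by rewrite classical_sets.setIC; apply: disj.
  + exact: disj.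
  + exact: matchM.
- move=> i iA; have [ia|ia] := boolP (meets i a).
    by exists a; rewrite setU11 amin //; split=> //; apply/asboolP.
  have [|j [jM ji ij]] := coverM i; first by rewrite inE iA.
  by exists j; rewrite setU1r.
Qed.

Definition corner (R : realType) (d : nat) (B : abox R d)
    (s : {ffun 'I_d -> bool}) : 'rV[R]_d :=
  \row_k (if s k then lo B 0 k else hi B 0 k).

(** In each coordinate, the interval of [B'] meets that of [B] and is at least
    as long, so it cannot lie in the interior of the latter. If it starts at or
    before the interval of [B], it contains the lower endpoint; otherwise it
    contains the upper one. *)
Lemma corner_in_larger_box (R : realType) (d : nat) (B B' : abox R d)
    (p : 'rV[R]_d) :
  (forall k, hi B 0 k - lo B 0 k <= hi B' 0 k - lo B' 0 k) ->
  abox_set B p -> abox_set B' p -> exists s, abox_set B' (corner B s).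
Proof.
move=> le_side pB pB'; exists [ffun k => lo B' 0 k <= lo B 0 k] => k.
rewrite mxE ffunE.
have /andP[lB hB] := pB k; have /andP[lB' hB'] := pB' k.
have [le_lo|/ltW le_lo] := leP (lo B' 0 k) (lo B 0 k).
  by rewrite le_lo (le_trans lB hB').
rewrite (le_trans lB' hB) /=.
by have := lerD (le_side k) le_lo; rewrite !subrK.
Qed.

Lemma covering_number_cubes (R : realType) (d : nat) (I : finType)
    (F : I -> abox R d) :
  (0 < d)%N -> (forall i, is_cube (F i)) ->
  (covering_number F <= 2 ^ d * matching_number F)%N.
Proof.
move=> d_gt0 cubeF; pose k0 := Ordinal d_gt0.
pose side i := hi (F i) 0 k0 - lo (F i) 0 k0.
have [M [_ matchM coverM]] := small_matching F side setT.
pose V := setX M [set: {ffun 'I_d -> bool}].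
pose P := [fset corner (F js.1) js.2 | js in V]%fset.
have coverP : is_cover F P.
  move=> i; have [//|j [jM le_ji [p [pi pj]]]] := coverM i.
  have [k|s s_in] := corner_in_larger_box _ pj pi.
    by rewrite (cubeF i k k0) (cubeF j k k0).
  exists (corner (F j) s) => //; apply/imfsetP; exists (j, s) => //=.
  by rewrite !inE jM.
apply: leq_trans (covering_number_leq coverP) _.
have cardV : #|V| = (2 ^ d * #|M|)%N.
  by rewrite cardsX cardsT card_ffun card_bool card_ord mulnC.
apply: (@leq_trans #|V|).
  by rewrite cardE; apply: leq_imfset_card.
by rewrite cardV leq_mul2l leq_matching_number ?orbT.
Qed.

Theorem theorem1p7 (R : realType) (d : nat) (hd : (1 <= d)%N) :
  exists c : R, forall (I : finType) (F : I -> abox R d),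
    (forall i : I, is_cube (F i)) ->
    (covering_number F)%:R <= c * (matching_number F)%:R.
Proof.
exists (2 ^ d)%:R => I F cubeF.
by rewrite -natrM ler_nat covering_number_cubes.
Qed.
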